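(* $r(I_4, L_3) = 15$ and $r(I_5, L_3) = 23$.
   Context: An oriented graph is a finite directed graph with no loops in which each pair of distinct vertices is joined by at most one arc (in one direction). $I_m$ denotes the edgeless graph on $m$ vertices (an independent set of size $m$) and $L_n$ denotes the transitive tournament on $n$ vertices. An oriented graph $D$ is $(I_m, L_n)$-free if it contains neither an independent set of $m$ vertices nor $n$ vertices inducing a transitive tournament. $r(I_m, L_n)$ is the least natural number $k$ such that no oriented graph on $k$ vertices is $(I_m, L_n)$-free. *)

(* Defs.v *)
From mathcomp Require Import all_boot.
Set Implicit Arguments.
Unset Strict Implicit.
Unset Printing Implicit Defensive.

Record oriented_graph := OrientedGraph {
  vertex :> finType;
  arc : rel vertex;
  arc_irrefl : irreflexive arc;
  arc_asym : forall x y : vertex, x != y -> ~~ (arc x y && arc y x)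
}.

Definition independent (D : oriented_graph) (S : {set D}) : Prop :=
  {in S &, forall x y, ~~ arc x y}.

(* At most one of the two arcs is already guaranteed by arc_asym. *)
Definition tournament (D : oriented_graph) (S : {set D}) : Prop :=
  {in S &, forall x y, x != y -> arc x y || arc y x}.

Definition transitive_tournament (D : oriented_graph) (S : {set D}) : Prop :=
  tournament S /\ {in S & &, transitive (@arc D)}.

Definition IL_free (m n : nat) (D : oriented_graph) : Prop :=
  ~ (exists S : {set D}, #|S| = m /\ independent S) /\
  ~ (exists S : {set D}, #|S| = n /\ transitive_tournament S).

Definition no_IL_free_on (m n k : nat) : Prop :=
  forall D : oriented_graph, #|D| = k -> ~ IL_free m n D.

(* [is_r m n k] is the relation r(I_m, L_n) = k. It is functional in k, since a
   least element is unique; asserting it includes the existence of the minimum. *)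
Definition is_r (m n k : nat) : Prop :=
  no_IL_free_on m n k /\ forall j : nat, no_IL_free_on m n j -> k <= j.

(* Main.v *)
(** In an [L_3]-free oriented graph every out- and in-neighbourhood is
    independent, so a set without independent [m.+1]-subset has at most
    [2m + 1 + b] vertices, where [b] bounds the sets without independent
    [m]-subset: this gives 3, 8, 15 for [m = 1, 2, 3], and 23 for [m = 4] once
    15 is improved to 14.  The two improvements 15 -> 14 and 23 -> 22 have the
    same proof.  In a graph attaining the bound all degrees are [m], and the
    non-neighbourhood [H] of a vertex [x] is extremal of the previous level.  If
    [H] is [(m-1)]-regular in both directions, every vertex of [H] has exactly
    one neighbour in [N+(x)] and one in [N-(x)]; counting arcs, all but two of
    the pairs in [N+(x) * N-(x)] are arcs, so some two vertices of [N+(x)] have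
    too many common out-neighbours.

    Regularity of [H] is a count for 8 vertices.  For 14 vertices a vertex
    of degree 5 has an 8-vertex non-neighbourhood, which is the Cayley graph of
    Z/8 with connection set {1, 6}; how these 8 vertices attach to the
    5 neighbours is a small constraint satisfaction problem, refuted by
    computation. *)

From mathcomp Require Import all_boot.
From mathcomp Require Import zify.
Require Import Defs.
Set Implicit Arguments.
Unset Strict Implicit.
Unset Printing Implicit Defensive.

(** * The constraint problem for attaching 8 vertices to 5 neighbours *)

Definition c8 (i j : nat) : bool :=
  j \in nth [::] [:: [:: 1; 6]; [:: 2; 7]; [:: 3; 0]; [:: 4; 1];
                     [:: 5; 2]; [:: 6; 3]; [:: 7; 4]; [:: 0; 5]] i.

(* A vertex [w] of the 8-vertex graph is attached to the five neighbours, which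
   are numbered 0, 1, 2 (out-neighbours) and 3, 4 (in-neighbours): [p.1] is the
   one [w] points to, [p.2] the one that points to [w], and 5 means none. *)
Definition attachments : seq (nat * nat) :=
  [seq p <- allpairs pair (iota 0 6) (iota 0 6) |
    ((p.1 == 5) || (p.1 != p.2)) && ((p.1 < 3) || (p.2 < 3))].

Definition touches (p : nat * nat) k := (p.1 == k) || (p.2 == k).

(** For an arc [w -> w'], with [p] attached to [w] and [q] to [w']: a common out-neighbour, a common
    in-neighbour or a path [w -> k -> w'] would each complete a transitive triangle. The cyclic
    triangle [w' -> k -> w] stays allowed. *)
Definition separated (p q : nat * nat) :=
  [&& (p.1 == 5) || (p.1 != q.1), (p.2 == 5) || (p.2 != q.2) &
      (p.1 == 5) || (p.1 != q.2)].

(** If this fails for non-adjacent [w], [w'] and non-adjacent [a], [b], then these four vertices are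
    independent. In [compat] it is imposed on the pairs known to be non-adjacent, inside 0, 1, 2 and
    inside 3, 4; mixed pairs wait for [unjoinable]. *)
Definition covered (p q : nat * nat) a b :=
  [|| touches p a, touches p b, touches q a | touches q b].

Definition compat i j (p q : nat * nat) :=
  if c8 i j then separated p q else
  if c8 j i then separated q p else
  [&& covered p q 0 1, covered p q 0 2, covered p q 1 2 & covered p q 3 4].

(* If [a -> w -> b] then [a, b] cannot be joined by an arc; if two non-adjacent
   vertices avoid both [a] and [b] then [a, b] must be joined. *)
Definition unjoinable (g : seq (nat * (nat * nat))) a b :=
  has (fun u => (u.2.2 == a) && (u.2.1 == b)) g &&
  has (fun u => has (fun v => [&& u.1 != v.1, ~~ c8 u.1 v.1, ~~ c8 v.1 u.1 &
                                  ~~ covered u.2 v.2 a b]) g) g.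

(* Backtracking with forward checking; [n] is fuel. *)
Fixpoint refute n (doms : seq (nat * seq (nat * nat))) g :=
  if doms is (i, d) :: doms' then
    if n is n'.+1 then
      all (fun p =>
        let doms'' := [seq (v.1, filter (compat i v.1 p) v.2) | v <- doms'] in
        has (fun v => nilp v.2) doms'' || refute n' doms'' ((i, p) :: g)) d
    else false
  else has (fun a => has (unjoinable g a) [:: 3; 4]) [:: 0; 1; 2].

(* A variable order, found by experiment, that keeps the search tree small. *)
Definition c8_order := [:: 0; 4; 6; 2; 1; 7; 5; 3].

Lemma refute_order : refute 8 [seq (i, attachments) | i <- c8_order] [::].
Proof. by vm_compute. Qed.

Section RefuteSound.

Variable f : nat -> nat * nat.
Hypothesis f_compat : forall i j,
  i < 8 -> j < 8 -> i != j -> compat i j (f i) (f j).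
Hypothesis f_join : forall r a b,
  all (fun i => i < 8) r -> a < 3 -> 2 < b < 5 ->
  ~~ unjoinable [seq (i, f i) | i <- r] a b.

(** Follow the branch that assigns to each variable its true value under [f]. By [f_compat] forward
    checking never deletes a true value, so no domain becomes empty, and by [f_join] the test at the
    leaf fails. *)
Lemma refuteP n (doms : seq (nat * seq (nat * nat))) r :
  all (fun i => i < 8) r -> uniq (unzip1 doms) ->
  (forall v, v \in doms -> v.1 < 8 /\ f v.1 \in v.2) ->
  ~~ refute n doms [seq (i, f i) | i <- r].
Proof.
elim: n doms r => [|n IH] [|[i d] doms] r r8 /=.
- by move=> _ _; rewrite !(negbTE (f_join r8 _ _)).
- by [].
- by move=> _ _; rewrite !(negbTE (f_join r8 _ _)).
case/andP=> i_notin uniq_doms in_doms.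
have [i8 fi] : i < 8 /\ f i \in d by apply: (in_doms (i, d)); rewrite mem_head.
apply/negP => /allP/(_ _ fi).
set doms' := map _ doms.
have in_doms' v : v \in doms' -> v.1 < 8 /\ f v.1 \in v.2.
  case/mapP=> u u_in ->; have [|u8 fu] := in_doms u.
    by rewrite inE u_in orbT.
  split=> //=; rewrite mem_filter fu andbT; apply: f_compat => //.
  by apply: contraNneq i_notin => ->; apply: map_f.
case/orP=> [/hasP[v /in_doms'[_ fv] /nilP v0]|]; first by rewrite v0 in fv.
apply/negP; have := IH doms' (i :: r); apply=> //=; first by rewrite i8.
by rewrite /unzip1 -map_comp.
Qed.

Lemma no_attachment : ~ (forall i, i < 8 -> f i \in attachments).
Proof.
move=> f_in; move: refute_order; apply/negP; apply: (@refuteP 8 _ [::]) => //.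
move=> _ /mapP[i i_in ->]; suff i8 : i < 8 by split=> //; apply: f_in.
by move: i i_in; apply/allP.
Qed.

End RefuteSound.

(** * Neighbourhoods, independent sets and the elementary bounds *)

Section LocalStructure.

Variables (T : finType) (e : rel T).
Hypothesis e_asym : forall x y, e x y -> ~~ e y x.
Hypothesis e_tt : forall x y z, e x y -> e y z -> ~~ e x z.

Implicit Types (x y z : T) (S R I : {set T}).

Definition adj x y := e x y || e y x.
Definition indep (S : {set T}) := [forall x in S, forall y in S, ~~ e x y].
Definition free m (S : {set T}) :=
  forall I : {set T}, I \subset S -> indep I -> #|I| < m.
Definition outn (S : {set T}) x := [set y in S | e x y].
Definition inn (S : {set T}) x := [set y in S | e y x].
Definition nonn (S : {set T}) x := [set y in S | (y != x) && ~~ adj x y].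

Lemma e_irr x : e x x = false.
Proof. by apply/negP => exx; move: (e_asym exx); rewrite exx. Qed.

Lemma adjC x y : adj x y = adj y x.
Proof. by rewrite /adj orbC. Qed.

Lemma indepP (S : {set T}) :
  reflect {in S &, forall x y, ~~ e x y} (indep S).
Proof.
apply: (iffP forall_inP) => [h x y xS yS|h x xS].
  by move/forall_inP: (h x xS); apply.
by apply/forall_inP => y yS; apply: h.
Qed.

Lemma indep1 x : indep [set x].
Proof. by apply/indepP => y z /set1P-> /set1P->; rewrite e_irr. Qed.

Lemma outn_sub S x : outn S x \subset S.
Proof. by apply/subsetP => y; rewrite inE => /andP[]. Qed.

Lemma inn_sub S x : inn S x \subset S.
Proof. by apply/subsetP => y; rewrite inE => /andP[]. Qed.

Lemma indep_outn S x : indep (outn S x).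
Proof.
apply/indepP => y z; rewrite !inE => /andP[_ xy] /andP[_ xz].
by apply/negP => yz; move: (e_tt xy yz); rewrite xz.
Qed.

Lemma indep_inn S x : indep (inn S x).
Proof.
apply/indepP => y z; rewrite !inE => /andP[_ yx] /andP[_ zx].
by apply/negP => yz; move: (e_tt yz zx); rewrite yx.
Qed.

Lemma card_outn m S x : free m.+1 S -> #|outn S x| <= m.
Proof. by move=> fS; apply: fS (outn_sub S x) (indep_outn S x). Qed.

Lemma card_inn m S x : free m.+1 S -> #|inn S x| <= m.
Proof. by move=> fS; apply: fS (inn_sub S x) (indep_inn S x). Qed.

Lemma indepU1 x (I : {set T}) :
  indep I -> {in I, forall y, ~~ adj x y} -> indep (x |: I).
Proof.
move/indepP=> hI hx; apply/indepP => y z; rewrite !inE.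
case/predU1P=> [->|yI] /predU1P[->|zI]; rewrite ?e_irr //.
- by move: (hx z zI); rewrite negb_or => /andP[].
- by move: (hx y yI); rewrite negb_or => /andP[].
- exact: hI.
Qed.

Lemma free_nonn m S x : x \in S -> free m.+1 S -> free m (nonn S x).
Proof.
move=> xS fS I /subsetP IS iI.
have xI : x \notin I by apply/negP => /IS; rewrite inE eqxx andbF.
have := fS (x |: I); rewrite cardsU1 xI add1n ltnS; apply.
  by rewrite subUset sub1set xS; apply/subsetP => y /IS; rewrite inE => /andP[].
by apply: indepU1 => // y /IS; rewrite inE => /and3P[].
Qed.

(** A vertex without neighbours in a maximum independent set could be added to it. *)
Lemma free_dom m S (I : {set T}) y : free m.+1 S -> I \subset S -> indep I ->
  #|I| = m -> y \in S -> y \notin I -> exists2 z, z \in I & adj y z.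
Proof.
move=> fS IS iI cI yS yI; apply/exists_inP; apply: contraT.
rewrite negb_exists_in => /forall_inP h.
have := fS (y |: I); rewrite cardsU1 yI cI add1n ltnn; apply.
  by rewrite subUset sub1set yS.
exact: indepU1.
Qed.

(** Stated for a subset [R] so that the neighbourhood of one vertex can be split by its position
    relative to another vertex [x]. *)
Lemma card_split S R x : R \subset S -> x \in S ->
  #|R| = (x \in R) + #|R :&: outn S x| + #|R :&: inn S x| + #|R :&: nonn S x|.
Proof.
move=> RS xS; have sub y : y \in R -> y \in S by move/(subsetP RS).
rewrite (cardsD1 x R) -!addnA; congr (_ + _).
rewrite -(cardsID (outn S x)) -[in LHS](cardsID (inn S x) (_ :\: outn S x)).
congr (_ + (_ + _));
  apply: eq_card => y; rewrite !inE /adj; move: (sub y);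
  case: (y \in R) => /= [->|]; rewrite ?andbF // ?andbT //=;
  have [->|_] := eqVneq y x; rewrite ?e_irr //=;
  by move: (@e_asym x y); case: (e x y); case: (e y x) => // /(_ isT).
Qed.

Lemma card_nbhd S x : x \in S ->
  #|S| = 1 + #|outn S x| + #|inn S x| + #|nonn S x|.
Proof.
move=> xS; rewrite (card_split (subxx S) xS) xS.
by congr (_ + _ + _ + _);
  apply: eq_card => y; rewrite !inE andbA andbb.
Qed.

Lemma free_bound m b S : (forall R, free m R -> #|R| <= b) ->
  free m.+1 S -> #|S| <= 1 + m + m + b.
Proof.
move=> hb fS; have [->|[x xS]] := set_0Vmem S; first by rewrite cards0.
rewrite (card_nbhd xS); have := card_outn x fS; have := card_inn x fS.
have := hb _ (free_nonn xS fS); lia.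
Qed.

Lemma free1_bound S : free 1 S -> #|S| <= 0.
Proof.
move=> fS; have [->|[x xS]] := set_0Vmem S; first by rewrite cards0.
by have := fS [set x]; rewrite sub1set xS indep1 cards1 => /(_ isT isT).
Qed.

Lemma free2_bound S : free 2 S -> #|S| <= 3.
Proof. exact: (free_bound free1_bound). Qed.

Lemma free3_bound S : free 3 S -> #|S| <= 8.
Proof. exact: (free_bound free2_bound). Qed.

Lemma free3_regular S x : free 3 S -> #|S| = 8 -> x \in S ->
  [/\ #|outn S x| = 2, #|inn S x| = 2 & #|nonn S x| = 3].
Proof.
move=> fS cS xS; have := card_outn x fS; have := card_inn x fS.
have := free2_bound (free_nonn xS fS).
by move: cS; rewrite (card_nbhd xS) => *; split; lia.
Qed.

(** * Impossibility of equality over a regular non-neighbourhood *)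

Section Gluing.

Variables (m : nat) (S : {set T}).
Hypothesis fS : free m.+1 S.
Hypothesis S_out : forall x, x \in S -> #|outn S x| = m.
Hypothesis S_in : forall x, x \in S -> #|inn S x| = m.
Hypothesis S_nonn_out : forall x y, x \in S -> y \in nonn S x ->
  #|outn (nonn S x) y| = m.-1.
Hypothesis S_nonn_in : forall x y, x \in S -> y \in nonn S x ->
  #|inn (nonn S x) y| = m.-1.

Definition nbr (R : {set T}) y := [set z in R | adj y z].

Lemma card_nbr R y : #|nbr R y| = #|outn R y| + #|inn R y|.
Proof.
rewrite -cardsUI (_ : outn R y :&: inn R y = set0) ?cards0 ?addn0.
  by apply: eq_card => z; rewrite !inE -andb_orr.
apply/setP => z; rewrite !inE; case: (boolP (e y z)); rewrite ?andbF //=.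
by move/e_asym/negbTE->; rewrite !andbF.
Qed.

(* [y] has one out- and one in-neighbour outside [nonn S x], while the maximal
   independent sets [outn S x] and [inn S x] each contain a neighbour of [y]. *)
Lemma card_nbr_outn x y : x \in S -> y \in nonn S x ->
  #|nbr (outn S x) y| = 1.
Proof.
move=> xS yH; have := yH; rewrite inE => /and3P[yS yx nxy].
have : #|nbr S y| = #|nbr (outn S x) y| + #|nbr (inn S x) y| + (m.-1 + m.-1).
  rewrite -{1}(S_nonn_out xS yH) -(S_nonn_in xS yH) -card_nbr.
  have nS : nbr S y \subset S by apply/subsetP => z; rewrite inE => /andP[].
  rewrite (card_split nS xS).
  rewrite inE [adj y x]adjC (negbTE nxy) andbF add0n.
  by congr (_ + _ + _);
    apply: eq_card => z; rewrite !inE; case: (z \in S); rewrite ?andbF //= andbC.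
rewrite card_nbr S_out // S_in //.
have pos R : R \subset S -> indep R -> #|R| = m -> y \notin R -> 0 < #|nbr R y|.
  move=> RS iR cR yR; have [z zR yz] := free_dom fS RS iR cR yS yR.
  by apply/card_gt0P; exists z; rewrite inE zR.
move: nxy; rewrite negb_or => /andP[nxy nyx].
have := pos (outn S x) (outn_sub S x) (indep_outn S x) (S_out xS).
have := pos (inn S x) (inn_sub S x) (indep_inn S x) (S_in xS).
rewrite ![y \in _]inE (negbTE nxy) (negbTE nyx) !andbF => /(_ isT) + /(_ isT).
lia.
Qed.

Lemma card_edges_sum (A H : {set T}) (r : rel T) :
  \sum_(x in A) #|[set y in H | r x y]| = \sum_(y in H) #|[set x in A | r x y]|.
Proof.
under eq_bigr do rewrite -sum1dep_card big_mkcondr.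
rewrite exchange_big /=; apply: eq_bigr => y yH.
by rewrite -sum1dep_card [RHS]big_mkcondr; apply: eq_bigr.
Qed.

(** The term [m * m.-1 + 2] is the size of a non-neighbourhood: 8 for [m = 3] and 14 for [m = 4].
    What exceeds [m * m.-1] bounds the arcs from [A] to [H]; these are too few to spread over three
    vertices of [A]. *)
Lemma no_tight_gluing : 2 < m -> S != set0 ->
  #|S| = 1 + m + m + (m * m.-1 + 2) -> False.
Proof.
move=> m_gt2 /set0Pn[x xS] cS.
set A := outn S x; set B := inn S x; set H := nonn S x.
have AP a : a \in A -> a \in S /\ e x a by rewrite inE => /andP[].
have cH : #|H| = m * m.-1 + 2.
  by have := card_nbhd xS; rewrite S_out // S_in // cS /H; lia.
have outA a : a \in A -> #|outn S a| = #|outn B a| + #|outn H a|.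
  move=> /AP[aS xa]; rewrite (card_split (outn_sub S a) xS).
  rewrite inE (negbTE (e_asym xa)) andbF add0n.
  rewrite (_ : outn S a :&: outn S x = set0) ?cards0 ?add0n.
    by congr (_ + _); apply: eq_card => z;
      rewrite !inE; case: (z \in S); rewrite ?andbF //= andbC.
  apply/setP => z; rewrite !inE; apply/negbTE/negP.
  by move=> /andP[/andP[_ az] /andP[_ xz]]; move: (e_tt xa az); rewrite xz.
(* An in-neighbour of [a] other than [x] lies neither in [A], which is independent, nor in [B],
   since [z -> x -> a] excludes [z -> a]. So it lies in [H]. *)
have inA a : a \in A -> m.-1 <= #|inn H a|.
  move=> /AP[aS xa]; have := S_in aS; rewrite (card_split (inn_sub S a) xS).
  rewrite (_ : inn S a :&: outn S x = set0) ?cards0; last first.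
    apply/setP => z; rewrite !inE; apply/negbTE/negP.
    by move=> /andP[/andP[_ za] /andP[_ xz]]; move: (e_tt xz za); rewrite xa.
  rewrite (_ : inn S a :&: inn S x = set0) ?cards0; last first.
    apply/setP => z; rewrite !inE; apply/negbTE/negP.
    by move=> /andP[/andP[_ za] /andP[_ zx]]; move: (e_tt zx xa); rewrite za.
  rewrite inE xS xa (_ : inn S a :&: nonn S x = inn H a); first by lia.
  by apply/setP => z; rewrite !inE; case: (z \in S); rewrite ?andbF //= andbC.
(* Each vertex of [H] has exactly one neighbour in [A], so there are [m * m.-1 + 2] arcs between [A]
   and [H], and at least [m * m.-1] of them enter [A]. *)
have AH : \sum_(a in A) #|outn H a| <= 2.
  have : \sum_(a in A) #|nbr H a| = #|H|.
    rewrite card_edges_sum -sum1_card; apply: eq_bigr => y yH.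
    rewrite -(card_nbr_outn xS yH).
    by apply: eq_card => z; rewrite !inE adjC.
  under eq_bigr do rewrite card_nbr.
  rewrite big_split /= cH.
  have : \sum_(a in A) m.-1 <= \sum_(a in A) #|inn H a| by apply: leq_sum.
  rewrite sum_nat_const S_out //; lia.
have [a aA a0] : exists2 a, a \in A & #|outn H a| = 0.
  have [/exists_inP[a aA /eqP]|] := boolP [exists a in A, #|outn H a| == 0].
    by exists a.
  rewrite negb_exists_in => /forall_inP h.
  have : \sum_(a in A) 1 <= \sum_(a in A) #|outn H a|.
    by apply: leq_sum => a /h; rewrite lt0n.
  rewrite sum1_card S_out //; lia.
have [a' aA' a1] : exists2 a', a' \in A :\ a & #|outn H a'| <= 1.
  have [/exists_inP[b bA hb]|] := boolP [exists b in A :\ a, #|outn H b| <= 1].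
    by exists b.
  rewrite negb_exists_in => /forall_inP h; move: AH; rewrite (big_setD1 a) //=.
  have : \sum_(b in A :\ a) 2 <= \sum_(b in A :\ a) #|outn H b|.
    by apply: leq_sum => b /h; rewrite -ltnNge.
  rewrite sum_nat_const; have := cardsD1 a A; rewrite aA S_out //; lia.
have {aA'} [neq aA'] := setD1P aA'.
have [aS xa] := AP a aA; have [aS' xa'] := AP a' aA'.
have a'H : a' \in nonn S a.
  have /indepP iA := indep_outn S x.
  by rewrite inE aS' neq negb_or !iA.
(* All [m] out-neighbours of [a] lie in [B], which has only [m] elements. *)
have BE : outn B a = B.
  apply/eqP; rewrite eqEcard outn_sub /=.
  by move: (outA a aA); rewrite a0 addn0 S_out // S_in // => ->.
(* The vertex [a'] is a non-neighbour of [a], so [card_nbr_outn] allows it one neighbour in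
   [outn S a], but it has at least [m.-1 >= 2] out-neighbours in [B]. *)
have : outn B a' \subset nbr (outn S a) a'.
  apply/subsetP => z; rewrite !inE => /andP[zB a'z].
  have : z \in outn B a by rewrite BE inE.
  by rewrite !inE /adj a'z => /andP[/andP[-> _] ->].
move/subset_leq_card; rewrite card_nbr_outn //.
have := outA a' aA'; rewrite S_out //; lia.
Qed.

End Gluing.

(** With 15 vertices [free_bound] is tight at every vertex: all degrees are 3, and each
    non-neighbourhood has 8 vertices and is regular by [free3_regular]. *)
Lemma free4_bound S : free 4 S -> #|S| <= 14.
Proof.
move=> fS; have := free_bound free3_bound fS.
rewrite leq_eqVlt => /predU1P[cS|]; last by rewrite ltnS.
have reg x : x \in S -> [/\ #|outn S x| = 3, #|inn S x| = 3 & #|nonn S x| = 8].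
  move=> xS; have := card_outn x fS; have := card_inn x fS.
  have := free3_bound (free_nonn xS fS).
  by move: cS; rewrite (card_nbhd xS) => *; split; lia.
have rn x y : x \in S -> y \in nonn S x ->
    [/\ #|outn (nonn S x) y| = 2, #|inn (nonn S x) y| = 2 &
        #|nonn (nonn S x) y| = 3].
  by move=> xS; apply: free3_regular (free_nonn xS fS) _; case: (reg x xS).
case: (@no_tight_gluing 3 S) => //.
- by move=> x /reg[].
- by move=> x /reg[].
- by move=> x y xS /(rn x y xS)[].
- by move=> x y xS /(rn x y xS)[].
- by rewrite -card_gt0 cS.
Qed.


(** * Uniqueness of the extremal graph on 8 vertices *)

Lemma free2_triangle S x : free 2 S -> #|S| = 3 -> x \in S ->
  #|outn S x| = 1 /\ #|inn S x| = 1.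
Proof.
move=> fS cS xS; have := card_outn x fS; have := card_inn x fS.
have := free1_bound (free_nonn xS fS).
by move: cS; rewrite (card_nbhd xS) => *; split; lia.
Qed.

Lemma free2_cycle S : free 2 S -> #|S| = 3 ->
  exists x y z, [/\ S = [set x; y; z], e x y, e y z & e z x].
Proof.
move=> fS cS.
have [x xS] : exists x, x \in S by apply/card_gt0P; rewrite cS.
have [/eqP/cards1P[y Ey] /eqP/cards1P[z Ez]] := free2_triangle fS cS xS.
have /andP[yS xy] : (y \in S) && e x y by have := set11 y; rewrite -Ey inE.
have /andP[zS zx] : (z \in S) && e z x by have := set11 z; rewrite -Ez inE.
have nyz : y != z by apply/eqP => E; move: (e_asym xy); rewrite E zx.
have nxy : x != y by apply/eqP => E; move: xy; rewrite E e_irr.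
have nxz : x != z by apply/eqP => E; move: zx; rewrite E e_irr.
exists x, y, z; split=> //.
  apply/esym/eqP; rewrite eqEcard cS -setUA !cardsU1 !inE cards1.
  by rewrite !subUset !sub1set xS yS zS negb_or nxy nxz nyz.
have : adj y z.
  apply: contraT => nadj.
  have : indep (y |: [set z]).
    by apply: indepU1 (indep1 z) _ => _ /set1P->.
  move/(fS (y |: [set z])); rewrite cardsU1 inE nyz cards1 subUset !sub1set.
  by rewrite yS zS => /(_ isT).
by case/orP=> // zy; move: (e_tt zx xy); rewrite zy.
Qed.

Lemma other_out S x u : #|outn S x| = 2 ->
  exists2 v, v \in S & (v != u) && e x v.
Proof.
move=> c2; have : 0 < #|outn S x :\ u|.
  by have := cardsD1 u (outn S x); rewrite c2; case: (_ \in _); lia.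
by case/card_gt0P=> v; rewrite !inE => /and3P[vu vS xv]; exists v; rewrite ?vu.
Qed.

Lemma other_in S x u : #|inn S x| = 2 ->
  exists2 v, v \in S & (v != u) && e v x.
Proof.
move=> c2; have : 0 < #|inn S x :\ u|.
  by have := cardsD1 u (inn S x); rewrite c2; case: (_ \in _); lia.
by case/card_gt0P=> v; rewrite !inE => /and3P[vu vS xv]; exists v; rewrite ?vu.
Qed.

Lemma set2_of_card2 (R : {set T}) u v w : #|R| = 2 -> u \in R -> v \in R ->
  u != v -> w \in R -> (w == u) || (w == v).
Proof.
move=> c2 uR vR uv; suff <- : [set u; v] = R by rewrite !inE.
by apply/eqP; rewrite eqEcard c2 cards2 uv subUset !sub1set uR vR.
Qed.

(** The position of a vertex in [s] is its label in Z/8. The default [x0] is arbitrary because all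
    indices are in range. *)
Definition c8_labelling S (s : seq T) :=
  [/\ size s = 8, uniq s, s =i S &
      forall x0 i j, i < 8 -> j < 8 -> e (nth x0 s i) (nth x0 s j) = c8 i j].

Section EightVertices.

Variable S : {set T}.
Hypothesis fS : free 3 S.
Hypothesis cS : #|S| = 8.

Let outS x : x \in S -> #|outn S x| = 2.
Proof. by move=> xS; case: (free3_regular fS cS xS). Qed.

Let inS x : x \in S -> #|inn S x| = 2.
Proof. by move=> xS; case: (free3_regular fS cS xS). Qed.

Lemma out_two x u v w : x \in S -> u \in S -> v \in S -> w \in S ->
  e x u -> e x v -> u != v -> e x w -> (w == u) || (w == v).
Proof.
move=> xS uS vS wS xu xv uv xw; apply: (set2_of_card2 (outS xS)) => //.
all: by rewrite inE; apply/andP.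
Qed.

Lemma in_two x u v w : x \in S -> u \in S -> v \in S -> w \in S ->
  e u x -> e v x -> u != v -> e w x -> (w == u) || (w == v).
Proof.
move=> xS uS vS wS xu xv uv xw; apply: (set2_of_card2 (inS xS)) => //.
all: by rewrite inE; apply/andP.
Qed.

Lemma no_three_out x u v w : x \in S -> u \in S -> v \in S -> w \in S ->
  e x u -> e x v -> e x w -> u != v -> u != w -> v != w -> False.
Proof.
move=> xS uS vS wS xu xv xw uv uw vw.
have := out_two xS uS vS wS xu xv uv xw.
by rewrite eq_sym (negbTE uw) eq_sym (negbTE vw).
Qed.

Lemma no_three_in x u v w : x \in S -> u \in S -> v \in S -> w \in S ->
  e u x -> e v x -> e w x -> u != v -> u != w -> v != w -> False.
Proof.
move=> xS uS vS wS ux vx wx uv uw vw.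
have := in_two xS uS vS wS ux vx uv wx.
by rewrite eq_sym (negbTE uw) eq_sym (negbTE vw).
Qed.

Lemma no_transitive x y z : e x y -> e y z -> e x z -> False.
Proof. by move=> xy yz xz; move: (e_tt xy yz); rewrite xz. Qed.

Lemma no_digon x y : e x y -> e y x -> False.
Proof. by move=> xy yx; move: (e_asym xy); rewrite yx. Qed.

Ltac neq := first [eassumption | rewrite eq_sym; eassumption].
(** A wrong arc is a loop, ends in an excluded vertex, closes a digon or a transitive triangle (in
    any of the three roles), or gives some vertex a third out- or in-neighbour. *)
Ltac refute_arc N :=
  exfalso;
  lazymatch type of N with is_true (e ?p ?q) =>
    first
    [ lazymatch q with p => by rewrite e_irr in N end
    | match goal with H : is_true (?x != ?x) |- _ => by rewrite eqxx in H end
    | match goal with K : is_true (e q p) |- _ => exact (no_digon N K) end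
    | match goal with K : is_true (e q ?r), L : is_true (e p ?r) |- _ =>
        exact (no_transitive N K L) end
    | match goal with K : is_true (e ?r p), L : is_true (e ?r q) |- _ =>
        exact (no_transitive K N L) end
    | match goal with K : is_true (e p ?r), L : is_true (e ?r q) |- _ =>
        exact (no_transitive K L N) end
    | match goal with
        K : is_true (e p ?u), L : is_true (e p ?v), D : is_true (?u != ?v)
        |- _ =>
        lazymatch u with q => fail | _ => lazymatch v with q => fail | _ =>
        apply: (no_three_out _ _ _ _ K L N D); neq end end end
    | match goal with
        K : is_true (e ?u q), L : is_true (e ?v q), D : is_true (?u != ?v)
        |- _ =>
        lazymatch u with p => fail | _ => lazymatch v with p => fail | _ =>
        apply: (no_three_in _ _ _ _ K L N D); neq end end end
    ] end.

(* The degrees are 2, so each arc found leaves only one possibility for the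
   next; the list is in the order of the labels in Z/8. *)
Lemma c8_from_forward z a1 a2 b1 b2 h0 h1 h2 :
  uniq [:: z; a1; b2; h2; h0; h1; a2; b1] ->
  [:: z; a1; b2; h2; h0; h1; a2; b1] =i S ->
  e z a1 -> e z a2 -> e b1 z -> e b2 z ->
  e h0 h1 -> e h1 h2 -> e h2 h0 -> e a2 h0 -> e h0 b2 ->
  c8_labelling S [:: z; a1; b2; h2; h0; h1; a2; b1].
Proof.
set s := [:: z; a1; b2; h2; h0; h1; a2; b1] => U sS za1 za2 b1z b2z.
move=> h01 h12 h20 a2h0 h0b2.
have zS : z \in S by rewrite -sS !inE eqxx ?orbT.
have a1S : a1 \in S by rewrite -sS !inE eqxx ?orbT.
have a2S : a2 \in S by rewrite -sS !inE eqxx ?orbT.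
have b1S : b1 \in S by rewrite -sS !inE eqxx ?orbT.
have b2S : b2 \in S by rewrite -sS !inE eqxx ?orbT.
have h0S : h0 \in S by rewrite -sS !inE eqxx ?orbT.
have h1S : h1 \in S by rewrite -sS !inE eqxx ?orbT.
have h2S : h2 \in S by rewrite -sS !inE eqxx ?orbT.
have := U; rewrite /= !inE !negb_or -!andbA.
do ![case/andP=> ?] => _.
have h1a2 : e h1 a2.
  have [v + /andP[neq +]] := other_in z (inS a2S).
  rewrite -sS !inE; do 7?[case/predU1P=> [?|]]; last move/eqP=> ?;
    subst v => N; first [exact: N | refute_arc N].
have h2a1 : e h2 a1.
  have [v + /andP[neq +]] := other_in z (inS a1S).
  rewrite -sS !inE; do 7?[case/predU1P=> [?|]]; last move/eqP=> ?;
    subst v => N; first [exact: N | refute_arc N].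
have b2h2 : e b2 h2.
  have [v + /andP[neq +]] := other_out z (outS b2S).
  rewrite -sS !inE; do 7?[case/predU1P=> [?|]]; last move/eqP=> ?;
    subst v => N; first [exact: N | refute_arc N].
have b1h1 : e b1 h1.
  have [v + /andP[neq +]] := other_out z (outS b1S).
  rewrite -sS !inE; do 7?[case/predU1P=> [?|]]; last move/eqP=> ?;
    subst v => N; first [exact: N | refute_arc N].
have a2b1 : e a2 b1.
  have [v + /andP[neq +]] := other_out h0 (outS a2S).
  rewrite -sS !inE; do 7?[case/predU1P=> [?|]]; last move/eqP=> ?;
    subst v => N; first [exact: N | refute_arc N].
have a1b2 : e a1 b2.
  have [v + /andP[neq +]] := other_out b1 (outS a1S).
  rewrite -sS !inE; do 7?[case/predU1P=> [?|]]; last move/eqP=> ?;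
    subst v => N; first [exact: N | refute_arc N].
have a1b1 : e a1 b1.
  have [v + /andP[neq +]] := other_out b2 (outS a1S).
  rewrite -sS !inE; do 7?[case/predU1P=> [?|]]; last move/eqP=> ?;
    subst v => N; first [exact: N | refute_arc N].
split=> // x0 i j i8 j8.
have out2 x u v w : x \in S -> u \in S -> v \in S -> w \in S ->
    e x u -> e x v -> u != v -> e x w = (w == u) || (w == v).
  move=> xS uS vS wS xu xv uv; apply/idP/idP; first exact: out_two.
  by case/orP=> /eqP->.
have sjS : nth x0 s j \in S by rewrite -sS mem_nth.
have nthE k : k < 8 -> (nth x0 s j == nth x0 s k) = (j == k).
  by move=> k8; rewrite nth_uniq.
rewrite /c8; case: i i8 => [|[|[|[|[|[|[|[|//]]]]]]]] _ /=.
all: rewrite !inE -!nthE //=.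
all: apply: out2 => //; neq.
Qed.


Lemma c8_from_arc z a2 h0 h1 h2 : z \in S -> nonn S z = [set h0; h1; h2] ->
  e h0 h1 -> e h1 h2 -> e h2 h0 -> a2 \in S -> e z a2 -> e a2 h0 ->
  exists s, c8_labelling S s.
Proof.
move=> zS HE h01 h12 h20 a2S za2 a2h0.
have hS y : y \in [set h0; h1; h2] -> [/\ y \in S, y != z & ~~ adj z y].
  by rewrite -HE inE => /and3P.
have [h0S h0z nzh0] := hS h0 ltac:(by rewrite !inE eqxx).
have [h1S h1z _] := hS h1 ltac:(by rewrite !inE eqxx orbT).
have [h2S h2z nzh2] := hS h2 ltac:(by rewrite !inE eqxx orbT).
have [a1 a1S /andP[a12 za1]] := other_out a2 (outS zS).
(* The in-neighbours of [z] form a maximum independent set, so one of them is adjacent to [h0]. It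
   cannot point to [h0], whose two in-neighbours are already [a2] and [h2]. *)
have [b2 b2S /andP[b2z h0b2]] : exists2 b2, b2 \in S & e b2 z && e h0 b2.
  have h0B : h0 \notin inn S z.
    by move: nzh0; rewrite inE negb_or => /andP[_ /negbTE->]; rewrite andbF.
  have [b] := free_dom fS (inn_sub S z) (indep_inn S z) (inS zS) h0S h0B.
  rewrite inE => /andP[bS bz] /orP[h0b|bh0].
    by exists b => //; rewrite bz.
  exfalso; apply: (no_three_in h0S _ _ _ a2h0 h20 bh0) => //.
  - by apply: contraNneq nzh2 => <-; rewrite /adj za2.
  - by apply/eqP => E; apply: (no_digon za2); rewrite E.
  - by apply: contraNneq nzh2 => ->; rewrite /adj bz orbT.
have [b1 b1S /andP[b12 b1z]] := other_in b2 (inS zS).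
exists [:: z; a1; b2; h2; h0; h1; a2; b1].
have sS : [:: z; a1; b2; h2; h0; h1; a2; b1] =i S.
  move=> y; apply/idP/idP => [|yS].
    by rewrite !inE; do 7?[case/predU1P=> [->|]] => //; move/eqP->.
  have [->|yz] := eqVneq y z; first by rewrite inE eqxx.
  have [zy|nzy] := boolP (e z y).
    have := out_two zS a1S a2S yS za1 za2 a12 zy.
    by rewrite !inE => /orP[] ->; rewrite !orbT.
  have [ez|nez] := boolP (e y z).
    have := in_two zS b1S b2S yS b1z b2z b12 ez.
    by rewrite !inE => /orP[] ->; rewrite !orbT.
  have : y \in nonn S z by rewrite inE yS yz negb_or nzy.
  by rewrite HE !inE -orbA => /or3P[] ->; rewrite !orbT.
apply: c8_from_forward => //.
by apply/card_uniqP; rewrite (eq_card sS) cS.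
Qed.

(** The non-neighbours of [z] form a cyclic triangle, each vertex of which is adjacent to some
    out-neighbour of [z]. If one such arc enters the triangle, a rotation reduces to [c8_from_arc].
    Otherwise all three leave it, and their ends are distinct because adjacent vertices have no
    common out-neighbour; then [z] has out-degree at least 3. *)
Lemma free3_c8 : exists s, c8_labelling S s.
Proof.
have [z zS] : exists z, z \in S by apply/card_gt0P; rewrite cS.
have [_ _ cH] := free3_regular fS cS zS.
have [g0 [g1 [g2 [HE g01 g12 g20]]]] := free2_cycle (free_nonn zS fS) cH.
have domA g : g \in [set g0; g1; g2] ->
    (exists2 a, a \in S & e z a && e a g) \/
    (exists2 a, a \in S & e z a && e g a).
  rewrite -HE inE => /and3P[gS gz]; rewrite negb_or => /andP[nzg _].
  have gA : g \notin outn S z by rewrite inE (negbTE nzg) andbF.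
  have [a] := free_dom fS (outn_sub S z) (indep_outn S z) (outS zS) gS gA.
  rewrite inE => /andP[aS za] /orP[ga|ag]; [right|left]; exists a => //.
    by rewrite za.
  by rewrite za.
have [[a aS /andP[za ag]]|[a aS /andP[za ga]]] :=
    domA g0 ltac:(by rewrite !inE eqxx).
  exact: (c8_from_arc zS HE g01 g12 g20 aS za ag).
have [[b bS /andP[zb bg]]|[b bS /andP[zb gb]]] :=
    domA g1 ltac:(by rewrite !inE eqxx orbT).
  by apply: (c8_from_arc zS _ g12 g20 g01 bS zb bg); rewrite HE -setUA setUC.
have [[c dS /andP[zc cg]]|[c dS /andP[zc gc]]] :=
    domA g2 ltac:(by rewrite !inE eqxx orbT).
  by apply: (c8_from_arc zS _ g20 g01 g12 dS zc cg); rewrite HE setUC setUA.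
exfalso; apply: (no_three_out zS aS bS dS za zb zc).
- by apply/eqP => E; apply: (no_transitive g01 gb); rewrite -E.
- by apply/eqP => E; apply: (no_transitive g20 ga); rewrite E.
- by apply/eqP => E; apply: (no_transitive g12 gc); rewrite -E.
Qed.

End EightVertices.


(** * Exclusion of a vertex with 3 out- and 2 in-neighbours *)

Section FourteenVertices.

Variables (S : {set T}) (y : T).
Hypothesis fS : free 4 S.
Hypothesis yS : y \in S.
Hypothesis y_out : #|outn S y| = 3.
Hypothesis y_in : #|inn S y| = 2.
Variable s : seq T.
Hypothesis sP : c8_labelling (nonn S y) s.

Let E := enum (outn S y) ++ enum (inn S y).
Let w i := nth y s i.
Let n k := nth y E k.

Let size_E : size E = 5.
Proof. by rewrite size_cat -!cardE y_out y_in. Qed.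

Let n_out k : k < 3 -> n k \in S /\ e y (n k).
Proof.
move=> k3; rewrite /n nth_cat -cardE y_out k3.
have : nth y (enum (outn S y)) k \in enum (outn S y).
  by rewrite mem_nth // -cardE y_out.
by rewrite mem_enum inE => /andP.
Qed.

Let n_in k : 2 < k < 5 -> n k \in S /\ e (n k) y.
Proof.
case/andP=> k2 k5; rewrite /n nth_cat -cardE y_out ltnNge k2 /=.
have : nth y (enum (inn S y)) (k - 3) \in enum (inn S y).
  by rewrite mem_nth // -cardE y_in ltn_subLR.
by rewrite mem_enum inE => /andP.
Qed.

Let n_adj k : k < 5 -> n k \in S /\ adj y (n k).
Proof.
move=> k5; have [/n_out[kS yk]|k3] := ltnP k 3; first by rewrite /adj yk.
by have [|kS ky] := @n_in k; rewrite ?k3 // /adj ky orbT.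
Qed.

Let uniq_E : uniq E.
Proof.
rewrite cat_uniq !enum_uniq andbT; apply/hasPn => x.
rewrite !mem_enum !inE => /andP[_ xy]; apply/negP => /andP[_ yx].
exact: (no_digon xy yx).
Qed.

Let w_in i : i < 8 -> [/\ w i \in nonn S y, w i \in S & ~~ adj y (w i)].
Proof.
move=> i8; have [ss _ sS _] := sP.
have : w i \in nonn S y by rewrite -sS mem_nth ?ss.
by move=> wW; split=> //; move: wW; rewrite inE => /and3P[].
Qed.

Let cW : #|nonn S y| = 8.
Proof.
by have [<- us sS _] := sP; rewrite -(eq_card sS); apply/card_uniqP.
Qed.

Let fW : free 3 (nonn S y) := free_nonn yS fS.

(** Two of the at most three out-neighbours of [w i] already lie in [nonn S y]. *)
Let one_out i u v : i < 8 -> u \in S -> v \in S -> adj y u -> adj y v ->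
  e (w i) u -> e (w i) v -> u = v.
Proof.
move=> i8 uS vS yu yv wu wv; apply: contraTeq (card_outn (w i) fS) => uv.
have [wW _ _] := w_in i8; have [o2 _ _] := free3_regular fW cW wW.
have : outn (nonn S y) (w i) :|: [set u; v] \subset outn S (w i).
  rewrite !subUset !sub1set !inE uS vS wu wv !andbT.
  by apply/subsetP => x; rewrite !inE -!andbA => /and4P[-> _ _ ->].
move/subset_leq_card; rewrite -ltnNge; apply: leq_trans.
rewrite cardsU o2 cards2 uv (_ : _ :&: _ = set0) ?cards0 //.
apply/setP => x; rewrite !inE; apply/negbTE/negP.
by case/andP=> /andP[/and3P[_ _ nyx] _] /orP[] /eqP xE;
  move: nyx; rewrite xE ?yu ?yv.
Qed.

Let one_in i u v : i < 8 -> u \in S -> v \in S -> adj y u -> adj y v ->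
  e u (w i) -> e v (w i) -> u = v.
Proof.
move=> i8 uS vS yu yv wu wv; apply: contraTeq (card_inn (w i) fS) => uv.
have [wW _ _] := w_in i8; have [_ o2 _] := free3_regular fW cW wW.
have : inn (nonn S y) (w i) :|: [set u; v] \subset inn S (w i).
  rewrite !subUset !sub1set !inE uS vS wu wv !andbT.
  by apply/subsetP => x; rewrite !inE -!andbA => /and4P[-> _ _ ->].
move/subset_leq_card; rewrite -ltnNge; apply: leq_trans.
rewrite cardsU o2 cards2 uv (_ : _ :&: _ = set0) ?cards0 //.
apply/setP => x; rewrite !inE; apply/negbTE/negP.
by case/andP=> /andP[/and3P[_ _ nyx] _] /orP[] /eqP xE;
  move: nyx; rewrite xE ?yu ?yv.
Qed.

(** When nothing is found, [find] returns [size E], which is 5, the code for no neighbour in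
    [attachments]. *)
Let f i := (find (e (w i)) E, find (fun x => e x (w i)) E).

Let f_out i k : i < 8 -> k < 5 -> ((f i).1 == k) = e (w i) (n k).
Proof.
move=> i8 k5; apply/eqP/idP => [fk|wn].
  by rewrite -fk; apply: nth_find; rewrite has_find size_E [find _ _]fk.
have hasE : has (e (w i)) E.
  by apply/hasP; exists (n k); rewrite ?mem_nth ?size_E.
have f5 : (f i).1 < 5 by rewrite -size_E -has_find.
have [[kS yk] [fS' yf]] := (n_adj k5, n_adj f5).
have := one_out i8 fS' kS yf yk (nth_find y hasE) wn.
by move/eqP; rewrite nth_uniq ?size_E // => /eqP.
Qed.

Let f_in i k : i < 8 -> k < 5 -> ((f i).2 == k) = e (n k) (w i).
Proof.
move=> i8 k5; apply/eqP/idP => [fk|wn].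
  rewrite -fk; apply: (@nth_find _ y (fun x => e x (w i))).
  by rewrite has_find size_E [find _ _]fk.
have hasE : has (fun x => e x (w i)) E.
  by apply/hasP; exists (n k); rewrite ?mem_nth ?size_E.
have f5 : (f i).2 < 5 by rewrite -size_E -has_find.
have [[kS yk] [fS' yf]] := (n_adj k5, n_adj f5).
have := one_in i8 fS' kS yf yk (nth_find y hasE) wn.
by move/eqP; rewrite nth_uniq ?size_E // => /eqP.
Qed.

Let f_touches i k : i < 8 -> k < 5 -> touches (f i) k = adj (w i) (n k).
Proof. by move=> i8 k5; rewrite /touches f_out // f_in. Qed.

Let f_le i : (f i).1 <= 5 /\ (f i).2 <= 5.
Proof. by rewrite -size_E; split; apply: find_size. Qed.

Let f_attachments i : i < 8 -> f i \in attachments.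
Proof.
move=> i8; have [o5 i5] := f_le i; have [_ wS nyw] := w_in i8.
rewrite mem_filter; apply/andP; split; last first.
  by apply/allpairsP; exists (f i); rewrite !mem_iota !ltnS o5 i5; split.
apply/andP; split.
  have [//|/= ne5] := eqVneq (f i).1 5; apply/eqP => fE.
  have lt5 : (f i).1 < 5 by rewrite ltn_neqAle ne5.
  apply: (@no_digon (w i) (n (f i).1)); first by rewrite -f_out.
  by rewrite -f_in //; apply/eqP; exact: esym fE.
(* The three out-neighbours of [y] form a maximum independent set, so [w i] is adjacent to one of
   them; this is the condition [< 3] in [attachments]. *)
have wA : w i \notin outn S y.
  by move: nyw; rewrite inE negb_or => /andP[/negbTE-> _]; rewrite andbF.
have [a aA wa] := free_dom fS (outn_sub S y) (indep_outn S y) y_out wS wA.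
have k3 : index a (enum (outn S y)) < 3.
  by rewrite -y_out cardE index_mem mem_enum.
have an : n (index a (enum (outn S y))) = a.
  by rewrite /n nth_cat index_mem mem_enum aA nth_index ?mem_enum.
have k5 : index a (enum (outn S y)) < 5 by apply: leq_trans k3 _.
move: wa; rewrite -an -f_touches // => /orP[] /eqP->; rewrite k3 ?orbT //.
Qed.

Let f_separated i j : i < 8 -> j < 8 -> e (w i) (w j) -> separated (f i) (f j).
Proof.
move=> i8 j8 wij; have [[o5 i5] [o5' i5']] := (f_le i, f_le j).
have lt5 k : k <= 5 -> k != 5 -> k < 5 by rewrite ltn_neqAle => -> ->.
apply/and3P; split; have [//|/= ne5] := eqVneq _ 5; apply/eqP => fE.
- have k5 := lt5 _ o5 ne5; apply: (@no_transitive _ _ (n (f i).1) wij).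
    by rewrite -f_out //; apply/eqP; exact: esym fE.
  by rewrite -f_out.
- have k5 := lt5 _ i5 ne5; apply: (@no_transitive (n (f i).2) _ _ _ wij).
    by rewrite -f_in.
  by rewrite -f_in //; apply/eqP; exact: esym fE.
have k5 := lt5 _ o5 ne5; apply: (@no_transitive _ (n (f i).1) _ _ _ wij).
  by rewrite -f_out.
by rewrite -f_in //; apply/eqP; exact: esym fE.
Qed.

(** Otherwise [n a], [n b], [w i], [w j] would be an independent 4-set. *)
Let f_covered i j a b : i < 8 -> j < 8 -> i != j -> ~~ adj (w i) (w j) ->
  a < 5 -> b < 5 -> a != b -> ~~ adj (n a) (n b) -> covered (f i) (f j) a b.
Proof.
move=> i8 j8 ij nij a5 b5 ab nab; rewrite /covered !f_touches //.
apply: contraT => /norP[nia /norP[nib /norP[nja njb]]].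
have [ss us _ _] := sP.
have [[_ iS nyi] [_ jS nyj]] := (w_in i8, w_in j8).
have [[aS ya] [bS yb]] := (n_adj a5, n_adj b5).
have wne k l : k < 5 -> l < 8 -> n k != w l.
  move=> k5 l8; have [_ yk] := n_adj k5; have [_ _ nyl] := w_in l8.
  by apply: contraNneq nyl => <-.
have iI : indep (n a |: (n b |: (w i |: [set w j]))).
  apply: indepU1; first (apply: indepU1; first apply: indepU1 (indep1 _) _).
  - by move=> _ /set1P->.
  - by move=> u; rewrite !inE => /orP[] /eqP->; rewrite adjC.
  by move=> u; rewrite !inE => /or3P[] /eqP-> //; rewrite adjC.
have sub : n a |: (n b |: (w i |: [set w j])) \subset S.
  by rewrite !subUset !sub1set aS bS iS jS.
have := fS sub iI; rewrite !cardsU1 !inE cards1 !negb_or !wne //.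
by rewrite !nth_uniq ?size_E ?ss // ab ij.
Qed.

Let nonadj_same a b : (a < 3) && (b < 3) || (2 < a < 5) && (2 < b < 5) ->
  ~~ adj (n a) (n b).
Proof.
rewrite /adj negb_or.
case/orP=> /andP[].
  move=> /n_out[aS ya] /n_out[bS yb]; have /indepP iA := indep_outn S y.
  by rewrite !iA // inE ?aS ?bS.
move=> /n_in[aS ya] /n_in[bS yb]; have /indepP iA := indep_inn S y.
by rewrite !iA // inE ?aS ?bS.
Qed.

Lemma no_five_nbrs : False.
Proof.
have wE i j : i < 8 -> j < 8 -> c8 i j = e (w i) (w j).
  by move=> i8 j8; have [_ _ _ ->] := sP.
apply: (@no_attachment f) f_attachments => [i j i8 j8 ij|r a b /allP r8 a3 b35].
  rewrite /compat !wE //; case: ifP => [|nij]; first exact: f_separated.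
  case: ifP => [|nji]; first exact: f_separated.
  have nadj : ~~ adj (w i) (w j) by rewrite /adj nij nji.
  by apply/and4P; split; apply: f_covered => //; apply: nonadj_same.
have b5 : b < 5 by case/andP: b35.
have a5 : a < 5 by apply: leq_trans a3 _.
have ab : a != b by rewrite neq_ltn (leq_trans a3) //; case/andP: b35.
(* Since [n b -> y -> n a], the arc [n b -> n a] is impossible. So either [n a -> n b], and no [w]
   lies on a path from [n a] to [n b], or the two are non-adjacent and [f_covered] applies. *)
rewrite negb_and; have [eab|neab] := boolP (e (n a) (n b)).
  apply/orP; left; apply/hasPn => _ /mapP[i /r8 i8 ->] /=.
  rewrite f_out // f_in //; apply/negP => /andP[ai ib].
  exact: (no_transitive ai ib eab).
apply/orP; right; apply/hasPn => _ /mapP[i /r8 i8 ->] /=.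
apply/hasPn => _ /mapP[j /r8 j8 ->] /=; rewrite !wE //.
apply/negP => /and4P[ij nij nji]; rewrite f_covered //.
  by rewrite negb_or nij.
have [[aS ya] [bS yb]] := (n_out a3, n_in b35).
by rewrite negb_or neab (e_tt yb ya).
Qed.

End FourteenVertices.

Lemma free4_out3_in2 S x : free 4 S -> #|S| = 14 -> x \in S ->
  #|outn S x| = 3 -> #|inn S x| != 2.
Proof.
move=> fS cS xS out3; apply/eqP => in2.
have cW : #|nonn S x| = 8 by have := card_nbhd xS; rewrite cS out3 in2; lia.
have [s sP] := free3_c8 (free_nonn xS fS) cW.
exact: (no_five_nbrs fS xS out3 in2 sP).
Qed.

End LocalStructure.

(** * Reversal of arcs and the upper bound 22 *)

Definition converse (T : finType) (e : rel T) : rel T := fun x y => e y x.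

Lemma free_converse (T : finType) (e : rel T) m (S : {set T}) :
  free e m S -> free (converse e) m S.
Proof.
move=> fS I IS /indepP iI; apply: fS IS _.
by apply/indepP => x y xI yI; apply: iI.
Qed.

Section UpperBound.

Variables (T : finType) (e : rel T).
Hypothesis e_asym : forall x y, e x y -> ~~ e y x.
Hypothesis e_tt : forall x y z, e x y -> e y z -> ~~ e x z.
Implicit Types (x y : T) (S : {set T}).

(** At most 8 non-neighbours leave at least 5 neighbours, so the degrees are (3,3), (3,2) or (2,3).
    [free4_out3_in2] excludes (3,2), and applied to the converse graph it excludes (2,3). *)
Lemma free4_regular S x : free e 4 S -> #|S| = 14 -> x \in S ->
  #|outn e S x| = 3 /\ #|inn e S x| = 3.
Proof.
move=> fS cS xS.
have := card_outn e_tt x fS; have := card_inn e_tt x fS.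
have := free3_bound e_asym e_tt (free_nonn e_asym xS fS).
have := free4_out3_in2 e_asym e_tt fS cS xS.
have c_asym y z : converse e y z -> ~~ converse e z y by apply: e_asym.
have c_tt u v w : converse e u v -> converse e v w -> ~~ converse e u w.
  by move=> vu wv; apply: e_tt wv vu.
have := free4_out3_in2 c_asym c_tt (free_converse fS) cS xS.
rewrite -[outn (converse e) S x]/(inn e S x).
rewrite -[inn (converse e) S x]/(outn e S x).
by move: cS; rewrite (card_nbhd e_asym xS); split; lia.
Qed.

Lemma free5_bound S : free e 5 S -> #|S| <= 22.
Proof.
move=> fS; have := free_bound e_asym e_tt (free4_bound e_asym e_tt) fS.
rewrite leq_eqVlt => /predU1P[cS|]; last by rewrite ltnS.
have reg x : x \in S ->
    [/\ #|outn e S x| = 4, #|inn e S x| = 4 & #|nonn e S x| = 14].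
  move=> xS; have := card_outn e_tt x fS; have := card_inn e_tt x fS.
  have := free4_bound e_asym e_tt (free_nonn e_asym xS fS).
  by move: cS; rewrite (card_nbhd e_asym xS) => *; split; lia.
have rn x y : x \in S -> y \in nonn e S x ->
    #|outn e (nonn e S x) y| = 3 /\ #|inn e (nonn e S x) y| = 3.
  move=> xS; apply: free4_regular (free_nonn e_asym xS fS) _.
  by case: (reg x xS).
case: (@no_tight_gluing _ e e_asym e_tt 4 S) => //.
- by move=> x /reg[].
- by move=> x /reg[].
- by move=> x y xS /(rn x y xS)[].
- by move=> x y xS /(rn x y xS)[].
- by rewrite -card_gt0 cS.
Qed.

End UpperBound.

(** * Translation from oriented graphs *)

Lemma IL_free_free m (D : oriented_graph) : IL_free m 3 D ->
  [/\ forall x y : D, arc x y -> ~~ arc y x,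
      forall x y z : D, arc x y -> arc y z -> ~~ arc x z &
      free (@arc D) m [set: D]].
Proof.
case=> noI noL.
have asym (x y : D) : arc x y -> ~~ arc y x.
  move=> xy; have nxy : x != y.
    by apply: contraTneq xy => ->; rewrite arc_irrefl.
  by have := arc_asym nxy; rewrite xy.
split=> // [x y z xy yz|I _ /indepP iI].
  apply/negP => xz; apply: noL; exists [set x; y; z].
  have neq (u v : D) : arc u v -> u != v.
    by apply: contraTneq => ->; rewrite arc_irrefl.
  have /negbTE yx := asym _ _ xy; have /negbTE zy := asym _ _ yz.
  have /negbTE zx := asym _ _ xz.
  split; first by rewrite -setUA !cardsU1 !inE cards1 negb_or !neq.
  have mem3 u : u \in [set x; y; z] -> [\/ u = x, u = y | u = z].
    by rewrite !inE -orbA => /or3P[] /eqP->;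
      [apply: Or31|apply: Or32|apply: Or33].
  split=> [u v|u v w] /mem3 + /mem3.
    by case=> -> [] ->; rewrite ?eqxx ?xy ?yz ?xz ?orbT.
  by move=> + + /mem3; do 3![case=> ->];
    rewrite ?arc_irrefl ?xy ?yz ?xz ?yx ?zy ?zx.
rewrite ltnNge; apply/negP => le_m; apply: noI.
(* [IL_free] forbids independent sets of exactly [m] vertices, so a larger one is cut down to that
   size. *)
have [J JI cJ] : exists2 J : {set D}, J \subset I & #|J| = m.
  exists [set u in take m (enum I)].
    by apply/subsetP => u; rewrite inE => /mem_take; rewrite mem_enum.
  rewrite cardsE (card_uniqP _) ?take_uniq ?enum_uniq //.
  by rewrite size_takel // -cardE.
exists J; split=> // u v /(subsetP JI) uI /(subsetP JI) vI; exact: iI.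
Qed.

(** * Lower bounds by explicit graphs *)

(** The inner loop chooses the first vertex of the set in list order, and only its later
    non-neighbours remain candidates. The search thus visits independent sets instead of all
    [m]-subsets. *)
Fixpoint no_indep (r : rel nat) m (l : seq nat) : bool :=
  if m is m'.+1 then
    (fix go l := if l is x :: l' then
       no_indep r m' [seq y <- l' | ~~ r x y && ~~ r y x] && go l' else true) l
  else false.

Lemma no_indepP r m l s : no_indep r m l -> subseq s l ->
  pairwise (fun x y => ~~ r x y && ~~ r y x) s -> size s != m.
Proof.
elim: m l s => [//|m IHm]; elim=> [[|//] //|x l IHl] [//|y s] /andP[hx hl].
rewrite [subseq _ _]/=; case: eqP => [->|_] sub /=; last exact: (IHl (y :: s)).
move=> /andP[xs ps]; rewrite eqSS; apply: (IHm _ _ hx) => //.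
by rewrite subseq_filter xs.
Qed.

Definition oriented_tt_free (r : rel nat) n :=
  let V := iota 0 n in
  all (fun i => all (fun j => r i j ==>
    ~~ r j i && all (fun k => r j k ==> ~~ r i k) V) V) V.

(** For [k <= n] the subgraph on the first [k] vertices is a counterexample, so one graph on [n]
    vertices rules out all these [k] at once. *)
Lemma IL_free_lower_bound m n r k : oriented_tt_free r n ->
  no_indep r m (iota 0 n) -> no_IL_free_on m 3 k -> n < k.
Proof.
move=> r_tt r_indep noD; rewrite ltnNge; apply/negP => kn.
have inV (i : 'I_k) : val i \in iota 0 n.
  by rewrite mem_iota (leq_trans (ltn_ord i)).
have asym (i j : 'I_k) : r i j -> ~~ r j i.
  move=> ij; have /allP/(_ _ (inV i))/allP/(_ _ (inV j)) := r_tt.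
  by rewrite ij => /andP[].
have tt (i j l : 'I_k) : r i j -> r j l -> ~~ r i l.
  move=> ij; have /allP/(_ _ (inV i))/allP/(_ _ (inV j)) := r_tt.
  by rewrite ij => /andP[_ /allP/(_ _ (inV l))/implyP].
have irr : irreflexive (fun i j : 'I_k => r i j).
  by move=> i; apply/negP => ii; move: (asym _ _ ii); rewrite ii.
have asym' (i j : 'I_k) : i != j -> ~~ (r i j && r j i).
  by move=> _; apply/negP => /andP[/asym/negP ji].
apply: (noD (OrientedGraph irr asym') (card_ord k)); split.
  case=> I [/= cI iI].
  have /eqP := cI; apply/negP; rewrite cardE -(size_map val).
  apply: no_indepP r_indep _ _.
    apply: (@subseq_trans _ (iota 0 k)).
      by rewrite -val_enum_ord; apply: map_subseq; rewrite enumT filter_subseq.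
    by rewrite -(subnKC kn) iotaD prefix_subseq.
  have {iI} iI i j : i \in enum I -> j \in enum I -> ~~ r i j.
    by rewrite !mem_enum; apply: iI.
  rewrite pairwise_map; elim: (enum I) iI => //= x l IHl iI; apply/andP; split.
    by apply/allP => y yl; rewrite /= !iI // inE ?eqxx ?yl ?orbT.
  by apply: IHl => i j il jl; apply: iI; rewrite inE ?il ?jl orbT.
case=> L [/= cL [tL trL]].
have /card_gt2P[x [y [z [[xL yL zL] [xy yz zx]]]]] : 2 < #|L| by rewrite cL.
(* Every tournament on three vertices contains a directed path with two arcs; transitivity would add
   the arc that [tt] forbids. *)
have no_path u v w : u \in L -> v \in L -> w \in L -> r u v -> r v w -> False.
  by move=> uL vL wL uv vw; have /negP[] := tt _ _ _ uv vw; apply: trL uv vw.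
have tot u v : u \in L -> v \in L -> u != v -> r u v \/ r v u.
  by move=> uL vL /(tL u v uL vL)/orP.
case: (tot x y) => // [rxy|ryx]; case: (tot y z) => // [ryz|rzy].
- exact: (no_path x y z).
- case: (tot z x) => // [rzx|rxz].
    exact: (no_path z x y).
  exact: (no_path x z y).
- case: (tot z x) => // [rzx|rxz].
    exact: (no_path y z x).
  exact: (no_path y x z).
- exact: (no_path z y x).
Qed.

(** Two copies of Z/7, on 0 to 6 and on 7 to 13, with arcs invariant under simultaneous rotation;
    each list holds the allowed differences [j - i]. Adding 14 keeps the subtraction from
    truncating. *)
Definition graph14 (i j : nat) : bool :=
  ((j + 14 - i) %% 7) \in
  match i < 7, j < 7 with
  | true, true => [:: 1; 3]
  | true, false => [:: 0]
  | false, true => [:: 6]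
  | false, false => [:: 1; 5]
  end.

(** The Cayley graph of Z/22 with connection set {1, 4, 10, 17}. *)
Definition graph22 (i j : nat) : bool :=
  ((j + 22 - i) %% 22) \in [:: 1; 4; 10; 17].

Lemma graph14_tt_free : oriented_tt_free graph14 14.
Proof. by vm_compute. Qed.

Lemma graph14_no_indep : no_indep graph14 4 (iota 0 14).
Proof. by vm_compute. Qed.

Lemma graph22_tt_free : oriented_tt_free graph22 22.
Proof. by vm_compute. Qed.

Lemma graph22_no_indep : no_indep graph22 5 (iota 0 22).
Proof. by vm_compute. Qed.

Theorem mainTheorem1 : is_r 4 3 15 /\ is_r 5 3 23.
Proof.
split; split.
- move=> D cD /IL_free_free[asym tt fD].
  by have := free4_bound asym tt fD; rewrite cardsT cD.
- by move=> k; apply: IL_free_lower_bound graph14_tt_free graph14_no_indep.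
- move=> D cD /IL_free_free[asym tt fD].
  by have := free5_bound asym tt fD; rewrite cardsT cD.
- by move=> k; apply: IL_free_lower_bound graph22_tt_free graph22_no_indep.
Qed.
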